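(* Let $V_0$ be a real reflexive Banach space, $A:V_0\times V_0\to\mathbb R$ a symmetric bilinear form, $L:V_0\to\mathbb R$ a linear functional, and $J_\theta:V_0\to\mathbb R$ a Gâteaux differentiable functional whose differential $J'_\theta({\bf u},{\bf v})$ is linear in ${\bf v}$. Suppose there are constants $M,B,T,D>0$ such that for all ${\bf u},{\bf v},{\bf w}\in V_0$ $$|A({\bf u},{\bf v})|\le M\|{\bf u}\|_{V_0}\|{\bf v}\|_{V_0},\quad A({\bf u},{\bf u})\ge B\|{\bf u}\|_{V_0}^2,\quad |L({\bf v})|\le T\|{\bf v}\|_{V_0},$$ $$J'_\theta({\bf u}+{\bf v},{\bf v})-J'_\theta({\bf u},{\bf v})\ge0,\qquad |J'_\theta({\bf u}+{\bf w},{\bf v})-J'_\theta({\bf u},{\bf v})|\le D\|{\bf v}\|_{V_0}\|{\bf w}\|_{V_0},$$ and for every ${\bf u}\in V_0$ there is $\tilde R>0$ with $|J'_\theta({\bf u},{\bf v})|\le\tilde R\|{\bf v}\|_{V_0}$ for all ${\bf v}\in V_0$. Let $G:V_0\times V_0\to\mathbb R$ be a symmetric bilinear form with constants $\tilde M,\tilde B>0$ such that $|G({\bf u},{\bf v})|\le\tilde M\|{\bf u}\|_{V_0}\|{\bf v}\|_{V_0}$ and $G({\bf u},{\bf u})\ge\tilde B\|{\bf u}\|_{V_0}^2$ for all ${\bf u},{\bf v}\in V_0$. Put $M_*=M+D$, let $\gamma\in(0;2B\tilde B/M_*^2)$, $q=\sqrt{1-\gamma(2B-\gamma M_*^2/\tilde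 B)/\tilde M}$ and $\|{\bf u}\|_G=\sqrt{G({\bf u},{\bf u})}$. Let $\mathfrak R:V_0\to V_0$ be the operator mapping ${\bf u}^k\in V_0$ to the unique solution ${\bf u}^{k+1}\in V_0$ of $$G({\bf u}^{k+1},{\bf v})=G({\bf u}^k,{\bf v})-\gamma\big[A({\bf u}^k,{\bf v})+J'_\theta({\bf u}^k,{\bf v})-L({\bf v})\big]\quad\forall\,{\bf v}\in V_0 ,$$ and let $\bar{\bf u}\in V_0$ be the exact solution of $A(\bar{\bf u},{\bf v})+J'_\theta(\bar{\bf u},{\bf v})-L({\bf v})=0$ for all ${\bf v}\in V_0$. Let ${\bf u}^0\in V_0$ and let $\breve{\bf u}^0={\bf u}^0+\boldsymbol\varepsilon^0$, $\breve{\bf u}^{k+1}=\mathfrak R(\breve{\bf u}^k)+\boldsymbol\varepsilon^{k+1}$, $k=0,1,\dots$, where the errors $\boldsymbol\varepsilon^k\in V_0$ are uniformly bounded: there is $\varepsilon>0$ with $\|\boldsymbol\varepsilon^k\|_G\le\varepsilon$ for all $k\in\{0,1,\dots\}$. Then $$\|\breve{\bf u}^k-\bar{\bf u}\|_G\le q^k\|{\bf u}^0-\bar{\bf u}\|_G+\frac{\varepsilon}{1-q}\qquad(k=0,1,\dots),$$ $$\|\breve{\bf u}^k-\bar{\bf u}\|_G\le\frac{q}{1-q}\|\breve{\bf u}^k-\breve{\bf u}^{k-1}\|_G+\frac{\varepsilon}{1-q}\qquad(k=1,2,\dots).$$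
   Context: Under the stated hypotheses the equation $A({\bf u},{\bf v})+J'_\theta({\bf u},{\bf v})-L({\bf v})=0$ for all ${\bf v}\in V_0$ has a unique solution in $V_0$ (the exact solution), the operator $\mathfrak R$ is well defined, and $0\le q<1$. *)

(* Defs.v *)
From HB Require Import structures.
From mathcomp Require Import all_boot all_order all_algebra.
From mathcomp Require Import all_classical all_reals all_analysis.

Set Implicit Arguments.
Unset Strict Implicit.
Unset Printing Implicit Defensive.

Import Order.TTheory GRing.Theory Num.Theory.
Import numFieldNormedType.Exports.

Local Open Scope classical_set_scope.
Local Open Scope ring_scope.

Definition continuous_dual (R : realType) (V : normedModType R) :
    set (V -> R) :=
  [set f : V -> R | scalar f /\ continuous f].

Definition dual_norm (R : realType) (V : normedModType R) (f : V -> R) : R :=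
  sup [set `|f x| | x in [set x : V | `|x| <= 1]].

(* An element of the bidual is represented by a function on all of [V -> R];
   only its values on the continuous linear functionals are ever used. *)
Definition bidual (R : realType) (V : normedModType R) :
    set ((V -> R) -> R) :=
  [set phi |
    (forall (a : R) (f g : V -> R), continuous_dual f -> continuous_dual g ->
       phi (fun x => a * f x + g x) = a * phi f + phi g) /\
    (exists C : R, forall f, continuous_dual f -> `|phi f| <= C * dual_norm f)].

(* The canonical embedding of [V] into its bidual is surjective. *)
Definition reflexive_space (R : realType) (V : normedModType R) : Prop :=
  forall phi, bidual phi ->
    exists x : V, forall f, continuous_dual f -> phi f = f x.

Definition form_norm (R : realType) (V : lmodType R) (G : V -> V -> R)
    (u : V) : R :=
  Num.sqrt (G u u).

Section Iteration.
Context (R : realType) (V : normedModType R).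
Variables (A G : V -> V -> R) (J L : V -> R) (gamma : R).

(* ['D_v J u] is the Gateaux differential of [J] at [u] in the direction [v]. *)
Definition residual (u v : V) : R := A u v + 'D_v J u - L v.

Definition iteration_step (u w : V) : Prop :=
  forall v : V, G w v = G u v - gamma * residual u v.

(* The solution [w] of [iteration_step u w]; the default value [0] is only
   taken if there is no solution. *)
Definition iteration_operator (u : V) : V :=
  xget 0 [set w | iteration_step u w].

End Iteration.

(* Main.v *)
Require Import Defs.
From mathcomp Require Import all_boot all_order all_algebra.
From mathcomp Require Import all_classical all_reals all_analysis.
From mathcomp Require Import ring lra.
Import Order.TTheory GRing.Theory Num.Theory.
Import numFieldNormedType.Exports.
Local Open Scope classical_set_scope.
Local Open Scope ring_scope.

(** The proof rests on two facts about the iteration operator.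

    It is a contraction with factor [q] in the norm of [G].  Two steps
    [u |-> w], [u' |-> w'] differ by [w - w' = d - z], where [d = u - u'] and
    [z] is the [G]-representative of [gamma] times the difference of the
    residuals.  Strong monotonicity of the residual, with constant [B], bounds
    the cross term [G z d] from below and its Lipschitz continuity, with
    constant [Ms = M + D], bounds [G z z] from above, so that
    [G (w - w') (w - w') <= q ^+ 2 * G d d]
    ([strongly_monotone_step_contraction]).

    It is really defined: every step equation has a solution, because a bounded
    linear functional is represented by the coercive symmetric form [G]
    ([riesz_representation]).  The representative is the minimizer of the
    quadratic energy [G w w - 2 * F w]; minimizing sequences are Cauchy by the
    parallelogram identity, and near-minimizers nearly solve the equation by a
    discriminant argument.

    The exact solution is a fixed point of the step equation, so the distances
    [a k] from the perturbed iterates to it satisfy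
    [a k.+1 <= q * a k + eps].  Unrolling this recursion gives the a priori
    bound; inserting the triangle inequality
    [a k <= form_norm G (ub k.+1 - ub k) + a k.+1] and solving for [a k.+1]
    gives the a posteriori bound. *)

(** * Symmetric positive forms *)

Lemma nonneg_quadratic_discriminant (R : rcfType) (a b c : R) :
  (forall t, 0 <= c + 2 * t * b + t ^+ 2 * a) -> b ^+ 2 <= c * a.
Proof.
move=> pos; pose p := Poly [:: c; 2 * b; a].
have: p`_1 ^+ 2 - 4 * p`_2 * p`_0 <= 0.
  rewrite deg_le2_poly_ge0 ?size_Poly// => t.
  rewrite horner_Poly /= mul0r add0r.
  by rewrite (_ : _ + c = c + 2 * t * b + t ^+ 2 * a)//; ring.
by rewrite !coefE /=; nra.
Qed.

Section SymmetricForm.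
Context {R : realType} {V : lmodType R} {G : {biscalar V}}.
Context (G_sym : forall u v : V, G u v = G v u).

Lemma form_addZ (x d : V) (t : R) :
  G (x + t *: d) (x + t *: d) = G x x + 2 * t * G x d + t ^+ 2 * G d d.
Proof.
have Zl u v : G (t *: u) v = t * G u v by exact: linearZl_LR.
have Zr u v : G u (t *: v) = t * G u v by exact: linearZr_LR.
by rewrite linearDl !linearDr /= !Zl !Zr (G_sym d x); ring.
Qed.

Context (G_ge0 : forall u : V, 0 <= G u u).

Lemma form_cauchy_schwarz (u v : V) : G u v <= form_norm G u * form_norm G v.
Proof.
apply: le_trans (ler_norm _) _; rewrite -sqrtr_sqr -sqrtrM// ler_wsqrtr//.
by apply: nonneg_quadratic_discriminant => t; rewrite -form_addZ.
Qed.

Lemma form_norm_ge0 (u : V) : 0 <= form_norm G u.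
Proof. exact: sqrtr_ge0. Qed.

Lemma sqr_form_norm (u : V) : form_norm G u ^+ 2 = G u u.
Proof. exact: sqr_sqrtr. Qed.

Lemma form_normD (u v : V) :
  form_norm G (u + v) <= form_norm G u + form_norm G v.
Proof.
rewrite -ler_sqr ?nnegrE ?addr_ge0 ?form_norm_ge0//.
rewrite sqrrD !sqr_form_norm.
have := form_addZ u v 1; rewrite scale1r => ->.
by have := form_cauchy_schwarz u v; lra.
Qed.

End SymmetricForm.

(** * Representation of bounded functionals by a coercive form *)

Definition energy {R : realType} {V : lmodType R} (G : V -> V -> R)
  (F : V -> R) (w : V) : R := G w w - 2 * F w.

Section Riesz.
Context {R : realType} {V : completeNormedModType R} {G : {biscalar V}}.
Context (G_sym : forall u v : V, G u v = G v u).
Context {M' B' : R} (B'_gt0 : 0 < B').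
Context (G_bounded : forall u v : V, `|G u v| <= M' * `|u| * `|v|).
Context (G_coercive : forall u : V, B' * `|u| ^+ 2 <= G u u).
Context {F : V -> R} (F_linear : scalar F).
Context {C : R} (F_bounded : forall v, `|F v| <= C * `|v|).

Local Notation E := (energy G F).

Lemma energy_addZ (x d : V) (t : R) :
  E (x + t *: d) = E x + 2 * t * (G x d - F d) + t ^+ 2 * G d d.
Proof.
by rewrite /energy form_addZ// [x + _]addrC F_linear; ring.
Qed.

(** Coercivity absorbs the linear term once the square
    [B' * (`|w| - C / B') ^+ 2] is completed. *)
Lemma energy_lower_bound (w : V) : - (C ^+ 2 / B') <= E w.
Proof.
have Fw : F w <= C * `|w| by apply: le_trans (ler_norm _) (F_bounded w).
have sq : 0 <= B' * (`|w| - C / B') ^+ 2 by rewrite mulr_ge0 ?sqr_ge0 ?ltW.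
have eq : B' * (`|w| - C / B') ^+ 2 =
    B' * `|w| ^+ 2 - 2 * (C * `|w|) + C ^+ 2 / B'.
  by field; rewrite gt_eqF.
by have := G_coercive w; rewrite /energy; lra.
Qed.

(** Strong convexity of the energy: the midpoint of two near-minimizers would
    fall below the lower bound [m] if they were far apart. *)
Lemma near_minimizers_close (m dx dy : R) (x y : V) :
  (forall w, m <= E w) -> E x <= m + dx -> E y <= m + dy ->
  B' * `|x - y| ^+ 2 <= 2 * (dx + dy).
Proof.
move=> mE Ex Ey; have := G_coercive (y - x); rewrite distrC => co.
have := energy_addZ x (y - x) 1; rewrite scale1r subrKC => Ey'.
(* the parallelogram identity, with the midpoint [x + 2^-1 *: (y - x)] *)
have := mE (x + 2^-1 *: (y - x)); rewrite energy_addZ => mid.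
by lra.
Qed.

(** Along the line through [x] in the direction [v], the energy minus [m] is a
    nonnegative quadratic polynomial whose linear coefficient is twice the
    residual; its discriminant is therefore not positive. *)
Lemma near_minimizer_residual (m d : R) (x v : V) :
  (forall w, m <= E w) -> E x <= m + d -> (G x v - F v) ^+ 2 <= d * G v v.
Proof.
move=> mE Ex; apply: nonneg_quadratic_discriminant => t.
by have := mE (x + t *: v); rewrite energy_addZ; lra.
Qed.

Lemma form_continuous_l (v : V) : continuous (G^~ v).
Proof.
move=> x; apply/cvgrPdist_le => e e0.
have K0 : 0 < `|M'| * `|v| + 1 by rewrite ltr_wpDl.
near=> y; rewrite -linearBl; apply: le_trans (G_bounded _ _) _.
have : `|x - y| <= e / (`|M'| * `|v| + 1).
  by near: y; apply: cvgr_dist_le => //; rewrite divr_gt0.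
rewrite ler_pdivlMr// => h; apply: le_trans h.
rewrite mulrDr mulr1 ler_wpDr// [leRHS]mulrCA [leRHS]mulrA.
by rewrite !ler_wpM2r// ler_norm.
Unshelve. all: by end_near. Qed.

(** [G w v = F v] is the Euler equation of the energy.  The limit of a
    minimizing sequence satisfies it without being shown to be a minimizer: the
    squared residual against [v] is at most [G v v] times the excess of energy,
    which tends to [0]. *)
Lemma riesz_representation : exists w : V, forall v, G w v = F v.
Proof.
pose S := range E; pose m := inf S.
have S_inf : has_inf S.
  split; first by exists (E 0), 0.
  by exists (- (C ^+ 2 / B')) => _ [w _ <-]; exact: energy_lower_bound.
have mE w : m <= E w by apply: ge_inf; [case: S_inf | exists w].
have minimizing n : exists w, E w <= m + harmonic n.
  have [_ [w _ <-] /ltW Ew] := inf_adherent (harmonic_gt0 n) S_inf.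
  by exists w.
have [x Ex] := choice minimizing.
have x_cauchy : cauchy (x @ \oo).
  apply/cauchy_exP => e e0.
  (* [near_minimizers_close] yields the factor 4; 5 makes the bound strict *)
  have d0 : 0 < B' * e ^+ 2 / 5 by rewrite divr_gt0 ?mulr_gt0 ?exprn_gt0.
  have := cvgr_le _ (@cvg_harmonic R) _ d0 => -[N _ small].
  exists (x N); exists N => // n /= Nn; rewrite -ball_normE /=.
  have close := near_minimizers_close _ _ _ _ _ mE (Ex N) (Ex n).
  have hN : harmonic N <= B' * e ^+ 2 / 5 := small N (leqnn N).
  have hn : harmonic n <= B' * e ^+ 2 / 5 := small n Nn.
  rewrite -ltr_sqr ?nnegrE ?(ltW e0)// -(ltr_pM2l B'_gt0).
  by apply: le_lt_trans close _; lra.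
have x_cvg : cvg (x @ \oo) by exact/cauchy_cvgP.
exists (lim (x @ \oo)) => v; apply/eqP; rewrite -subr_eq0 -sqrf_eq0.
rewrite eq_le sqr_ge0 andbT.
have res_cvg : (fun n => (G (x n) v - F v) ^+ 2) @ \oo -->
    (G (lim (x @ \oo)) v - F v) ^+ 2.
  have Gx : (fun n => G (x n) v) @ \oo --> G (lim (x @ \oo)) v.
    apply: (@continuous_cvg _ _ _ _ _ x (G^~ v)) => //.
    exact: form_continuous_l.
  by apply: cvgM; apply: cvgB => //; apply: cvg_cst.
have bound_cvg : (fun n => harmonic n * G v v) @ \oo --> (0 : R).
  by rewrite -(mul0r (G v v)); apply: cvgMl; exact: cvg_harmonic.
apply: ler_cvg_to res_cvg bound_cvg _; apply: nearW => n.
exact: near_minimizer_residual.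
Qed.

End Riesz.

(** * Contraction and error accumulation *)

(** Damped steps for a strongly monotone Lipschitz operator [Phi] contract in
    the [G]-norm.  With [d = u - u'], the squared norm of [w - w'] is at most
    [G d d - gamma * (2 * B - gamma * K ^+ 2 / B') * `|d| ^+ 2]; coercivity of
    [G] serves to bound the Lipschitz term, and boundedness of [G] to turn
    [`|d| ^+ 2] back into [G d d].  If the radicand is negative, then
    [G d d = 0] and both sides are [0]. *)
Lemma strongly_monotone_step_contraction {R : realType} {V : normedModType R}
    {G : {biscalar V}} (G_sym : forall u v : V, G u v = G v u)
    {M' B' : R} (M'_gt0 : 0 < M') (B'_gt0 : 0 < B')
    (G_bounded : forall u v : V, `|G u v| <= M' * `|u| * `|v|)
    (G_coercive : forall u : V, B' * `|u| ^+ 2 <= G u u)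
    {Phi : V -> V -> R} {B K gamma : R}
    (gamma_ge0 : 0 <= gamma) (rate_ge0 : 0 <= 2 * B - gamma * K ^+ 2 / B')
    {u u' w w' : V}
    (Phi_monotone :
       B * `|u - u'| ^+ 2 <= Phi u (u - u') - Phi u' (u - u'))
    (Phi_lipschitz :
       forall v, `|Phi u v - Phi u' v| <= K * `|u - u'| * `|v|)
    (w_step : forall v, G w v = G u v - gamma * Phi u v)
    (w'_step : forall v, G w' v = G u' v - gamma * Phi u' v) :
  form_norm G (w - w') <=
    Num.sqrt (1 - gamma * (2 * B - gamma * K ^+ 2 / B') / M') *
    form_norm G (u - u').
Proof.
set d := u - u'; pose z := d - (w - w').
have G_ge0 x : 0 <= G x x.
  by apply: le_trans (G_coercive x); rewrite mulr_ge0 ?sqr_ge0 ?ltW.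
have zE v : G z v = gamma * (Phi u v - Phi u' v).
  by rewrite /z /d !linearBl /= w_step w'_step; ring.
have zz_le : G z z <= gamma * K * `|d| * `|z|.
  rewrite zE -!mulrA ler_wpM2l// mulrA.
  exact: le_trans (ler_norm _) (Phi_lipschitz z).
(* absorbs [`|z|] by [B' * `|z| ^+ 2 <= G z z] and [2 x y <= x^2 + y^2] *)
have zz_le' : G z z <= gamma ^+ 2 * K ^+ 2 / B' * `|d| ^+ 2.
  have := G_coercive z; set g := G z z in zz_le *; set c := gamma * K * `|d|.
  rewrite (_ : gamma ^+ 2 * K ^+ 2 / B' * `|d| ^+ 2 = c ^+ 2 / B'); last first.
    by rewrite /c; field; rewrite gt_eqF.
  rewrite ler_pdivlMr// => co.
  have : 0 <= (c - B' * `|z|) ^+ 2 by exact: sqr_ge0.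
  move: zz_le; rewrite -/c; nra.
have zd_ge : gamma * B * `|d| ^+ 2 <= G d z.
  by rewrite G_sym zE -mulrA ler_wpM2l.
have dd_le : G d d / M' <= `|d| ^+ 2.
  rewrite ler_pdivrMr// mulrC expr2 mulrA.
  exact: le_trans (ler_norm _) (G_bounded _ _).
rewrite /form_norm mulrC -sqrtrM// ler_wsqrtr//.
have -> : w - w' = d + (-1) *: z by rewrite scaleN1r /z opprB subrKC.
rewrite form_addZ//.
(* the gain is a nonnegative multiple of [`|d| ^+ 2], so it may be measured in
   the norm of [G] *)
have rate : gamma * (2 * B - gamma * K ^+ 2 / B') * (G d d / M') <=
    gamma * (2 * B - gamma * K ^+ 2 / B') * `|d| ^+ 2.
  by rewrite ler_wpM2l// mulr_ge0.
by lra.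
Qed.

(** The initial value carries an error [e] of its own, which the geometric sum
    [e / (1 - q)] of all the errors includes. *)
Lemma affine_recursion_bound (R : realFieldType) (q c e : R) (a : nat -> R) :
  0 <= q -> q < 1 -> a 0%N <= c + e -> 0 <= e ->
  (forall k, a k.+1 <= q * a k + e) ->
  forall k, a k <= q ^+ k * c + e / (1 - q).
Proof.
move=> q0 q1 a0 e0 aS.
have q1' : 0 < 1 - q by rewrite subr_gt0.
have fix_e : e / (1 - q) = q * (e / (1 - q)) + e by field; rewrite gt_eqF.
have e_le : e <= e / (1 - q).
  by rewrite [leRHS]fix_e lerDr mulr_ge0// divr_ge0// ltW.
elim=> [|k IH]; first by rewrite expr0 mul1r (le_trans a0)// lerD2l.
apply: le_trans (aS k) _; rewrite exprS fix_e.
by have := ler_wpM2l q0 IH; lra.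
Qed.

Theorem corollary1 (R : realType) (V : completeNormedModType R)
    (V_reflexive : reflexive_space V)
    (A : {biscalar V}) (A_sym : forall u v : V, A u v = A v u)
    (L : {scalar V})
    (J : V -> R)
    (J_gateaux : forall u v : V, derivable J u v)
    (dJ_linear : forall u : V, scalar (fun v : V => 'D_v J u))
    (M B T D : R)
    (M_gt0 : 0 < M) (B_gt0 : 0 < B) (T_gt0 : 0 < T) (D_gt0 : 0 < D)
    (A_bounded : forall u v : V, `|A u v| <= M * `|u| * `|v|)
    (A_coercive : forall u : V, B * `|u| ^+ 2 <= A u u)
    (L_bounded : forall v : V, `|L v| <= T * `|v|)
    (dJ_monotone : forall u v : V, 0 <= 'D_v J (u + v) - 'D_v J u)
    (dJ_lipschitz : forall u v w : V,
       `|'D_v J (u + w) - 'D_v J u| <= D * `|v| * `|w|)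
    (dJ_bounded : forall u : V, exists2 R' : R, 0 < R' &
       forall v : V, `|'D_v J u| <= R' * `|v|)
    (G : {biscalar V}) (G_sym : forall u v : V, G u v = G v u)
    (M' B' : R) (M'_gt0 : 0 < M') (B'_gt0 : 0 < B')
    (G_bounded : forall u v : V, `|G u v| <= M' * `|u| * `|v|)
    (G_coercive : forall u : V, B' * `|u| ^+ 2 <= G u u)
    (Ms gamma q : R)
    (Ms_def : Ms = M + D)
    (gamma_gt0 : 0 < gamma) (gamma_lt : gamma < 2 * B * B' / Ms ^+ 2)
    (q_def : q =
       Num.sqrt (1 - gamma * (2 * B - gamma * Ms ^+ 2 / B') / M'))
    (ubar : V)
    (ubar_solution : forall v : V, A ubar v + 'D_v J ubar - L v = 0)
    (u0 : V) (err ub : nat -> V)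
    (ub0 : ub 0%N = u0 + err 0%N)
    (ubS : forall k : nat,
       ub k.+1 = iteration_operator A G J L gamma (ub k) + err k.+1)
    (eps : R) (eps_gt0 : 0 < eps)
    (err_bounded : forall k : nat, form_norm G (err k) <= eps) :
  (forall k : nat,
     form_norm G (ub k - ubar) <=
       q ^+ k * form_norm G (u0 - ubar) + eps / (1 - q)) /\
  (forall k : nat, (1 <= k)%N ->
     form_norm G (ub k - ubar) <=
       q / (1 - q) * form_norm G (ub k - ub k.-1) + eps / (1 - q)).
Proof.
have G_ge0 x : 0 <= G x x.
  by apply: le_trans (G_coercive x); rewrite mulr_ge0 ?sqr_ge0 ?ltW.
have Ms_gt0 : 0 < Ms by rewrite Ms_def addr_gt0.
have rate_gt0 : 0 < 2 * B - gamma * Ms ^+ 2 / B'.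
  rewrite subr_gt0 ltr_pdivrMr// -ltr_pdivlMr ?exprn_gt0//.
have q_ge0 : 0 <= q by rewrite q_def sqrtr_ge0.
have q_lt1 : q < 1.
  rewrite q_def -[ltRHS]sqrtr1 ltr_sqrt// gtrDl oppr_lt0.
  by rewrite divr_gt0 ?mulr_gt0.
pose Phi := residual A J L.
have Phi_lipschitz u u' v : `|Phi u v - Phi u' v| <= Ms * `|u - u'| * `|v|.
  have -> : Phi u v - Phi u' v = A (u - u') v + ('D_v J u - 'D_v J u').
    by rewrite /Phi /residual linearBl /=; ring.
  have dJ := dJ_lipschitz u' v (u - u'); rewrite subrKC in dJ.
  apply: le_trans (ler_normD _ _) _.
  by have := A_bounded (u - u') v; rewrite Ms_def; lra.
have Phi_monotone u u' :
    B * `|u - u'| ^+ 2 <= Phi u (u - u') - Phi u' (u - u').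
  have dJ := dJ_monotone u' (u - u'); rewrite subrKC in dJ.
  have := A_coercive (u - u').
  by rewrite /Phi /residual {1}linearBl /=; lra.
have stepP u : iteration_step A G J L gamma u
    (iteration_operator A G J L gamma u).
  (* the right-hand side of the step equation is a bounded functional of [v] *)
  apply: xgetPex; have [R' _ dJ] := dJ_bounded u.
  apply: (riesz_representation G_sym B'_gt0 G_bounded G_coercive
    (F := fun v => G u v - gamma * residual A J L u v) _
    (C := M' * `|u| + gamma * (M * `|u| + R' + T))).
    move=> a x y; rewrite /residual dJ_linear !linearPr /=.
    by rewrite [L _]linearP /=; ring.
  move=> v; apply: le_trans (ler_normB _ _) _.
  rewrite normrM gtr0_norm// mulrDl lerD// -mulrA ler_wpM2l ?(ltW gamma_gt0)//.
  apply: le_trans (ler_normB _ _) _; rewrite mulrDl lerD//.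
  by apply: le_trans (ler_normD _ _) _; rewrite mulrDl lerD.
have step_ubar : iteration_step A G J L gamma ubar ubar.
  by move=> v; rewrite /residual ubar_solution mulr0 subr0.
have error_step k :
    form_norm G (ub k.+1 - ubar) <= q * form_norm G (ub k - ubar) + eps.
  rewrite ubS addrAC; apply: le_trans (form_normD G_sym G_ge0 _ _) _.
  rewrite lerD// q_def.
  exact: (strongly_monotone_step_contraction G_sym M'_gt0 B'_gt0 G_bounded
    G_coercive (ltW gamma_gt0) (ltW rate_gt0) (Phi_monotone _ _)
    (Phi_lipschitz _ _) (stepP _) step_ubar).
split.
  apply: affine_recursion_bound => //; last exact: ltW.
  rewrite ub0 addrAC; apply: le_trans (form_normD G_sym G_ge0 _ _) _.
  by rewrite lerD.
case=> // k _ /=; have q1 : 0 < 1 - q by rewrite subr_gt0.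
have tri : form_norm G (ub k - ubar) <=
    form_norm G (ub k.+1 - ub k) + form_norm G (ub k.+1 - ubar).
  have -> : form_norm G (ub k.+1 - ub k) = form_norm G (ub k - ub k.+1).
    by rewrite -opprB /form_norm linearNl linearNr /= opprK.
  rewrite -[X in X - ubar](subrK (ub k.+1)) -addrA.
  exact: form_normD.
rewrite mulrAC -mulrDl ler_pdivlMr//.
by have := error_step k; have := ler_wpM2l q_ge0 tri; lra.
Qed.
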